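(* Let $\mathfrak{E},\mathfrak{H},\mathfrak{K}$ be Hilbert spaces, let $A\in\mathbf{B}(\mathfrak{E},\mathfrak{H})$ and $B\in\mathbf{B}(\mathfrak{E},\mathfrak{K})$, and assume that $B$ is dominated or almost dominated by $A$. Let $\mathfrak{E}_0=\overline{\operatorname{ran}}(A^*A+B^*B)$, let $A_0$ and $B_0$ be the restrictions of $A$ and $B$ to $\mathfrak{E}_0$, and let $C_{A_0}\in\mathbf{B}(\mathfrak{E}_0,\mathfrak{H})$ and $C_{B_0}\in\mathbf{B}(\mathfrak{E}_0,\mathfrak{K})$ be the unique operators with $$A_0=C_{A_0}\bigl((A_0)^*A_0+(B_0)^*B_0\bigr)^{1/2},\qquad B_0=C_{B_0}\bigl((A_0)^*A_0+(B_0)^*B_0\bigr)^{1/2}.$$ Then the Radon-Nikodym derivative $R(A,B)$ of $B$ with respect to $A$ is given by the quotient $$R(A,B)=C_{B_0}(C_{A_0})^{-1},$$ where $\ker C_{A_0}\subset\ker C_{B_0}$.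
   Context: $\mathbf{B}(\mathfrak{X},\mathfrak{Y})$ denotes the everywhere defined bounded linear operators from the Hilbert space $\mathfrak{X}$ to the Hilbert space $\mathfrak{Y}$; $\overline{\operatorname{ran}}$ denotes the closure of the range. A linear relation $T$ from $\mathfrak{H}$ to $\mathfrak{K}$ is a linear subspace of $\mathfrak{H}\times\mathfrak{K}$, with elements written $\{f,g\}$; operators are identified with their graphs; $T^{**}$ is the closure of $T$. The quotient $C_{B_0}(C_{A_0})^{-1}$ is the product in the sense of linear relations, i.e. $C_{B_0}(C_{A_0})^{-1}=\{\{C_{A_0}f,C_{B_0}f\}:f\in\mathfrak{E}_0\}$. $L(A,B)=\{\{Af,Bf\}:f\in\mathfrak{E}\}$. $B$ is dominated by $A$ if there is $c>0$ with $\|Bf\|\le c\|Af\|$ for all $f\in\mathfrak{E}$. $B$ is almost dominated by $A$ if there exist Hilbert spaces $\mathfrak{K}_n$, operators $B_n\in\mathbf{B}(\mathfrak{E},\mathfrak{K}_n)$ and numbers $c_n\ge0$ such that for all $f\in\mathfrak{E}$: (a) $\|B_nf\|\le c_n\|Af\|$; (b) $\|B_nf\|\le\|B_{n+1}f\|$; (c) $\|B_nf\|\nearrow\|Bf\|$. In either case $L(A,B)^{**}$ is (the graph of) a closed linear operator from $\mathfrak{H}$ to $\mathfrak{K}$, and the Radon-Nikodym derivative of $B$ with respect to $A$ is $R(A,B)=L(A,B)^{**}$. *)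

(* Defs.v *)
From HB Require Import structures.
From mathcomp Require Import all_boot all_order all_algebra.
From mathcomp Require Import all_classical all_reals all_analysis.
From mathcomp Require Export complex.

Set Implicit Arguments.
Unset Strict Implicit.
Unset Printing Implicit Defensive.

Import Order.TTheory GRing.Theory Num.Theory.
Import numFieldNormedType.Exports.

Local Open Scope classical_set_scope.
Local Open Scope ring_scope.

(** Complex Hilbert spaces.  The scalars are [R[i]] with [R : realType]; norms
    take values in [R[i]], whose order makes every [x >= 0] real.  The inner
    product is linear in its first argument, conjugate-linear in the second. *)
HB.mixin Record CompleteNormedModule_isHilbert (R : realType) V
    & CompleteNormedModule R[i] V := {
  inner : {dot V for @Num.conj R[i]} ;
  inner_norm : forall x : V, inner x x = `|x| ^+ 2
}.

#[short(type="hilbertType")]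
HB.structure Definition Hilbert (R : realType) :=
  {V of CompleteNormedModule R[i] V & CompleteNormedModule_isHilbert R V}.

Record bop (R : realType) (X Y : hilbertType R) := Bop {
  bop_lin :> {linear X -> Y} ;
  bop_bounded : exists2 M : R[i], 0 <= M & forall x, `|bop_lin x| <= M * `|x|
}.

Notation "''B' ( X , Y )" := (bop X Y)
  (at level 8, format "''B' ( X ,  Y )") : type_scope.

Record closedSubspace (R : realType) (E : hilbertType R) := ClosedSubspace {
  csub_set : set E ;
  csub_submod : submod_closed (fun x => x \in csub_set) ;
  csub_closed : closed csub_set
}.

Section ClosedSubspaceHilbert.
Context (R : realType) (E : hilbertType R) (S : closedSubspace E).

Definition csub_pred : pred E := fun x => x \in csub_set S.

HB.instance Definition _ :=
  GRing.isSubmodClosed.Build R[i] E csub_pred (csub_submod S).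

Record csub := Csub { csub_val : E ; _ : csub_pred csub_val }.

HB.instance Definition _ := [isSub for csub_val].
HB.instance Definition _ := [Choice of csub by <:].
HB.instance Definition _ := [SubChoice_isSubLmodule of csub by <:].

Let norm (x : csub) : R[i] := `|val x|.

Let ler_csub_normD (x y : csub) : norm (x + y) <= norm x + norm y.
Proof. by rewrite /norm raddfD ler_normD. Qed.

Let csub_normrZ (l : R[i]) (x : csub) : norm (l *: x) = `|l| * norm x.
Proof. by rewrite /norm linearZ normrZ. Qed.

Let csub_normr0_eq0 (x : csub) : norm x = 0 -> x = 0.
Proof. by move=> /normr0_eq0 x0; apply: val_inj; rewrite x0 raddf0. Qed.

HB.instance Definition _ := @Lmodule_isNormed.Build R[i] csub
  norm ler_csub_normD csub_normrZ csub_normr0_eq0.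

Lemma ball_csub (x : csub) (e : R[i]) : ball x e = val @^-1` ball (val x) e.
Proof.
by apply/seteqP; split=> y; rewrite -!ball_normE /= /ball_ /=
  -[`|x - y|]/`|val (x - y)| raddfB.
Qed.

Let csub_cauchy_cvg (F : set_system csub) :
  ProperFilter F -> cauchy F -> cvg F.
Proof.
move=> FF /cauchyP Fc.
have /cauchy_cvg/cvg_ex[l Fl] : cauchy (val @ F).
  by apply/cauchyP => e /Fc[x xF]; exists (val x); rewrite ball_csub in xF.
have Sl : csub_pred l.
  apply/mem_set; apply: (closed_cvg _ (@csub_closed _ _ S) _ _ Fl).
  by apply: nearW => x; apply/set_mem; case: x.
apply/cvg_ex; exists (Csub Sl); apply/cvg_ballP => e e0.
by move/cvg_ballP : Fl => /(_ e e0); apply: filterS => x; rewrite ball_csub.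
Qed.

HB.instance Definition _ := Uniform_isComplete.Build csub csub_cauchy_cvg.

Definition csub_inner (x y : csub) : R[i] := inner (val x) (val y).

Let csub_inner_bilinear : bilinear_for
  (GRing.Scale.Law.clone _ _ ( *%R ) _)
  (GRing.Scale.Law.clone _ _ (@Num.conj R[i] \; *%R) _) csub_inner.
Proof. by split=> u a x y; rewrite /csub_inner linearP //=; exact: linearPl. Qed.

HB.instance Definition _ := bilinear_isBilinear.Build R[i] csub csub R[i] _ _
  csub_inner csub_inner_bilinear.

Let csub_inner_hermitian (x y : csub) :
  csub_inner x y = (-1) ^+ false * Num.conj (csub_inner y x).
Proof. exact: hermitian_subproof. Qed.

HB.instance Definition _ := isHermitianSesquilinear.Build R[i] csub false
  (@Num.conj R[i]) csub_inner csub_inner_hermitian.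

Let csub_inner_gt0 (x : csub) : x != 0 -> 0 < csub_inner x x.
Proof.
move=> x0; apply: neq0_dnorm_gt0; apply: contra_neq x0 => vx0.
by apply: val_inj; rewrite vx0 raddf0.
Qed.

HB.instance Definition _ := isDotProduct.Build R[i] csub csub_inner
  csub_inner_gt0.

Let csub_inner_norm (x : csub) : csub_inner x x = `|x| ^+ 2.
Proof. exact: inner_norm. Qed.

HB.instance Definition _ := CompleteNormedModule_isHilbert.Build R csub
  csub_inner_norm.

End ClosedSubspaceHilbert.

Coercion csub : closedSubspace >-> Sortclass.

Section BoundedOperators.
Context (R : realType).
Implicit Types X Y Z : hilbertType R.

Fact bop_add_bounded X Y (T S : 'B(X, Y)) :
  exists2 M : R[i], 0 <= M & forall x, `|(T \+ S) x| <= M * `|x|.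
Proof.
have [M M0 TM] := bop_bounded T; have [N N0 SN] := bop_bounded S.
exists (M + N) => [|x /=]; first exact: addr_ge0.
by rewrite mulrDl (le_trans (ler_normD _ _))// lerD.
Qed.

Definition bop_add X Y (T S : 'B(X, Y)) : 'B(X, Y) :=
  Bop (bop_add_bounded T S).

Fact bop_comp_bounded X Y Z (T : 'B(Y, Z)) (S : 'B(X, Y)) :
  exists2 M : R[i], 0 <= M & forall x, `|(T \o S) x| <= M * `|x|.
Proof.
have [M M0 TM] := bop_bounded T; have [N N0 SN] := bop_bounded S.
exists (M * N) => [|x /=]; first exact: mulr_ge0.
by rewrite (le_trans (TM _))// -mulrA ler_wpM2l.
Qed.

Definition bop_comp X Y Z (T : 'B(Y, Z)) (S : 'B(X, Y)) : 'B(X, Z) :=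
  Bop (bop_comp_bounded T S).

Fact bop_restr_bounded X Y (T : 'B(X, Y)) (S : closedSubspace X) :
  exists2 M : R[i], 0 <= M & forall x, `|(T \o (val : S -> X)) x| <= M * `|x|.
Proof. by have [M M0 TM] := bop_bounded T; exists M => // x /=. Qed.

Definition bop_restr X Y (T : 'B(X, Y)) (S : closedSubspace X) : 'B(S, Y) :=
  Bop (bop_restr_bounded T S).

Fact closure_range_submod X Y (T : 'B(X, Y)) :
  submod_closed (fun y => y \in closure (range T)).
Proof.
split=> [|a x y /set_mem cx /set_mem cy]; apply/mem_set.
  by apply: subset_closure; exists 0 => //; rewrite linear0.
move=> U nU.
have /(_ U nU)[[V W] /= [nV nW] VWU] :
    (fun z : Y * Y => a *: z.1 + z.2) @ (x, y) --> a *: x + y.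
  apply: cvgD; last exact: cvg_snd.
  by apply: cvgZl_tmp; exact: cvg_fst.
have [_ [[u _ <-] Vu]] := cx _ nV; have [_ [[w _ <-] Ww]] := cy _ nW.
exists (T (a *: u + w)); split; first by exists (a *: u + w).
by rewrite linearP; exact: (VWU (T u, T w)).
Qed.

Definition clos_ran X Y (T : 'B(X, Y)) : closedSubspace Y :=
  ClosedSubspace (closure_range_submod T) (@closed_closure _ (range T)).

Definition is_adjoint X Y (T : 'B(X, Y)) (T' : 'B(Y, X)) : Prop :=
  forall x y, inner (T x) y = inner x (T' y).

Definition is_nonneg X (T : 'B(X, X)) : Prop :=
  is_adjoint T T /\ forall x, 0 <= inner (T x) x.

Definition is_sqrt X (T S : 'B(X, X)) : Prop :=
  is_nonneg S /\ forall x, S (S x) = T x.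

Definition ker X Y (T : 'B(X, Y)) : set X := [set x | T x = 0].

Definition graph X Y (T : 'B(X, Y)) : set (X * Y) := [set p | p.2 = T p.1].

(** The library's [T \; S] is the relation [T] after [S]. *)
Definition quotient X Y Z (B : 'B(X, Z)) (A : 'B(X, Y)) : set (Y * Z) :=
  (graph B \; (graph A)^-1)%relation.

Definition Lrel X Y Z (A : 'B(X, Y)) (B : 'B(X, Z)) : set (Y * Z) :=
  range (fun f => (A f, B f)).

(** [T^**] is the closure of [T] in the product space. *)
Definition RNderiv X Y Z (A : 'B(X, Y)) (B : 'B(X, Z)) : set (Y * Z) :=
  closure (Lrel A B).

Definition dominated X Y Z (B : 'B(X, Z)) (A : 'B(X, Y)) : Prop :=
  exists2 c : R[i], 0 < c & forall f, `|B f| <= c * `|A f|.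

Definition almost_dominated X Y Z (B : 'B(X, Z)) (A : 'B(X, Y)) : Prop :=
  exists (K_ : nat -> hilbertType R) (B_ : forall n, 'B(X, K_ n))
         (c : nat -> R[i]),
    (forall n, 0 <= c n) /\
    forall f, [/\ forall n, `|B_ n f| <= c n * `|A f|,
                  forall n, `|B_ n f| <= `|B_ n.+1 f| &
                  (fun n => `|B_ n f| : R[i]^o) @ \oo --> (`|B f| : R[i]^o)].

End BoundedOperators.

(* Main.v *)
Require Import Defs.
From mathcomp Require Import all_boot all_order all_algebra.
From mathcomp Require Import all_classical all_reals all_analysis complex.
From mathcomp Require Import ring.

(** Put [T = A'A + B'B], write [c g = (A g, B g)], so that [L(A, B)] is the
    range of [c] and [|A g|^2 + |B g|^2 = <g, T g>], and let [V x = (CA0 x,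
    CB0 x)] on [E0].  The quotient of [CB0] by [CA0] is the range of [V]
    ([quotientE]), so the claim is that the closure of the range of [c] is the
    range of [V], together with an inclusion of kernels.

    The factorizations say [c = V S] on [E0], where [S] is the square root of
    the restriction of [T].  As [|S f|^2 = <f, T f> = |c f|^2], the map [V] is
    isometric on the range of [S]; as [S] has dense range in [E0], [V] is
    bounded below on [E0] ([bounded_below_dense]), and its range is closed
    because [E0] is complete ([closed_range_expanding]).  By density again,
    [V x] is a limit of vectors [V (S f) = c f], so the range of [V] lies in
    the closure of the range of [c].  Conversely, it suffices that every [c g]
    is a limit of vectors [c h] with [h] in [E0].

    Both density facts follow from one explicit approximation, which replaces
    the orthogonal decomposition along [E0] and the kernel of [T].  For a large
    real [M] put [U = 1 - T / M].  Then [|U x|^2 <= |x|^2 - <x, T x> / M], so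
    the numbers [<x, T x>] at [x = U^n g] are summable; but [U^n g] has the
    form [g - T r], and [<x, T x> = |c x|^2], so [c g] is approximated by
    [c (T r)] ([gram_approx], [gram_pair_dense]).  Applying the continuous map
    [(u, v) |-> A' u + B' v] to this approximation shows that [T g] is a limit
    of vectors [T (T r) = S (S (T r))], which gives the density of the range
    of [S].

    Finally, if [CA0 x = 0] then [(0, CB0 x) = V x] lies in the closure of
    [L(A, B)].  Almost domination forces such a second component to vanish
    ([almost_dominated_closable]); domination is the special case of a constant
    sequence of operators. *)

Set Implicit Arguments.
Unset Strict Implicit.
Unset Printing Implicit Defensive.

Import Order.TTheory GRing.Theory Num.Theory.
Import numFieldNormedType.Exports.

Local Open Scope classical_set_scope.
Local Open Scope ring_scope.

(** * Closures and closed ranges *)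

Lemma closure_image (X Y : topologicalType) (f : X -> Y) (P : set X) (x : X) :
  continuous f -> closure P x -> closure (f @` P) (f x).
Proof.
move=> fc Px U /fc nU; have [z [Pz Uz]] := Px _ nU.
by exists (f z); split=> //; exists z.
Qed.

Lemma closure_normP (K : numFieldType) (V : normedModType K) (P : set V) (p : V) :
  closure P p <-> forall e, 0 < e -> exists2 q, P q & `|p - q| < e.
Proof.
split=> [Pp e e0|Pp U /nbhs_normP[e e0 eU]].
  have [q [Pq pq]] := Pp _ (nbhsx_ballx p e e0).
  by exists q; rewrite // -ball_normE in pq.
by have [q Pq pq] := Pp e e0; exists q; split=> //; exact: eU.
Qed.

(** The preimages of balls around a point of the closure form a Cauchy filter,
    by the lower bound; its limit is sent to that point by continuity. *)
Lemma closed_range_expanding (K : numFieldType) (X : completeNormedModType K)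
    (Y : normedModType K) (c : K) (f : X -> Y) :
  0 < c -> continuous f -> (forall x y, `|x - y| <= c * `|f x - f y|) ->
  closed (range f).
Proof.
move=> c0 fc fe p /closure_normP fp.
pose F := filter_from [set e : K | 0 < e] (fun e => [set x | `|p - f x| < e]).
have FF : ProperFilter F.
  apply: filter_from_proper => [|e /fp[_ [x _ <-] px]]; last by exists x.
  apply: filter_from_filter; first by exists 1; rewrite /= ltr01.
  move=> d e d0 e0; have de : d >=< e by rewrite real_comparable ?gtr0_real.
  exists (Order.min d e); first by rewrite /= comparable_lt_min ?d0.
  by move=> x /=; rewrite comparable_lt_min// => /andP[].
have /cauchy_cvg/cvg_ex[/= l Fl] : cauchy F.
  apply: cauchy_exP => e e0.
  (* Two points with images within [e / (2 c)] of [p] are less than [e] apart. *)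
  have e'0 : 0 < e / c / 2 by rewrite !divr_gt0.
  have [_ [x _ <-] px] := fp _ e'0; exists x, (e / c / 2) => //= y /= py.
  rewrite -ball_normE /=; apply: (le_lt_trans (fe x y)).
  rewrite -(subrK p (f x)) -addrA mulrC -ltr_pdivlMr//.
  by rewrite (le_lt_trans (ler_normD _ _))// distrC [ltRHS]splitr ltrD.
exists l => //; apply/eqP; rewrite -subr_eq0 -normr_le0; apply/ler_addgt0Pr => e e0.
have e20 : 0 < e / 2 by rewrite divr_gt0.
have fl : f @ F --> f l by apply: cvg_trans (fc l); exact: cvg_app.
have /cvgr_dist_lt/(_ _ e20)[d /= d0 dl] := fl.
have m0 : 0 < Order.min d (e / 2).
  by rewrite comparable_lt_min ?d0 ?e20// real_comparable ?gtr0_real.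
have [_ [x _ <-]] := fp _ m0.
rewrite comparable_lt_min ?real_comparable ?gtr0_real// => /andP[/dl lx px].
rewrite add0r -(subrK (f x) (f l)) -addrA ltW// (le_lt_trans (ler_normD _ _))//.
by rewrite [e]splitr ltrD// distrC.
Qed.

Lemma bounded_below_dense (K : numFieldType) (X Y : normedModType K) (c : K)
    (f : X -> Y) (D : set X) :
  0 < c -> continuous f -> closure D = setT ->
  (forall x, D x -> `|x| <= c * `|f x|) -> forall x, `|x| <= c * `|f x|.
Proof.
move=> c0 fc Dd fD x; apply/ler_addgt0Pr => e e0.
have e20 : 0 < e / 2 by rewrite divr_gt0.
have e2c0 : 0 < e / 2 / c by rewrite divr_gt0.
have nx : nbhs x [set y | `|x - y| < e / 2 /\ `|f x - f y| < e / 2 / c].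
  apply: filterI.
    by have /cvgrPdist_lt/(_ _ e20) : id @ x --> x by exact: cvg_id.
  by have /cvgrPdist_lt/(_ _ e2c0) := fc x.
have : closure D x by rewrite Dd.
move=> /(_ _ nx)[y [/fD Dy [xy fxy]]].
have fy : c * `|f y| <= c * `|f x| + e / 2.
  rewrite -(subKr (f x) (f y)) (le_trans (ler_wpM2l (ltW c0) (ler_normB _ _)))//.
  by rewrite mulrDr lerD2l mulrC -ler_pdivlMr// ltW.
rewrite -(subrK y x) addrC (le_trans (ler_normD _ _))// subrKC.
by rewrite (le_trans (lerD (le_trans Dy fy) (ltW xy)))// -addrA -splitr.
Qed.

(** * Order estimates in the complex field *)

(** The bound telescopes to [e * n <= a 0] as long as every [q] up to [n] is at
    least [e], which the Archimedean property of the real scalars rules out. *)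
Lemma descent_small (R : realType) (a q : nat -> R[i]) (e : R[i]) :
  (forall n, 0 <= a n) -> (forall n, 0 <= q n) ->
  (forall n, a n.+1 <= a n - q n) -> 0 < e -> exists n, q n < e.
Proof.
move=> a0 q0 aq e0; apply: contrapT => nq.
have qe n : e <= q n.
  by rewrite real_leNgt ?ger0_real// ?ltW//; apply/negP => qn; apply: nq; exists n.
have an n : a n <= a 0%N - e *+ n.
  elim: n => [|n IHn]; first by rewrite subr0.
  by rewrite (le_trans (aq n))// mulrSr opprD addrA lerB.
have ae_real : a 0%N / e \is Num.real by rewrite ger0_real// divr_ge0// ltW.
have [n aen] : exists n, a 0%N / e < n%:R.
  exists (Num.bound (complex.Re (a 0%N / e))).
  have := archi_boundP (x := complex.Re (a 0%N / e)).
  rewrite -!ltcR -!lecR (RRe_real ae_real) rmorph_nat; apply.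
  by rewrite divr_ge0// ltW.
have := le_trans (a0 n) (an n).
by rewrite subr_ge0 -mulr_natr mulrC -ler_pdivlMr// => /(lt_le_trans aen); rewrite ltxx.
Qed.

(** The order of [R[i]] is only partial, so monotone convergence is needed for
    real-valued sequences of complex numbers, such as norms. *)
Lemma nondecreasing_cvg_bounds (R : realType) (u : nat -> R[i]) (l : R[i]) :
  (forall n, u n \is Num.real) -> l \is Num.real ->
  (forall n, u n <= u n.+1) -> (u : nat -> R[i]^o) @ \oo --> (l : R[i]^o) ->
  (forall n, u n <= l) /\ forall c, (forall n, u n <= c) -> l <= c.
Proof.
move=> ur lr undec ul.
have le_u m n : (m <= n)%N -> u m <= u n.
  elim: n m => [|n IHn] m; rewrite leq_eqVlt => /predU1P[->//|//].
  by move=> /IHn /le_trans; apply.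
have near_l e n : 0 < e -> exists2 m, (n <= m)%N & `|l - u m| < e.
  move=> e0; have /cvgrPdist_lt/(_ e e0)[N _ Ne] := ul.
  by exists (maxn n N); [exact: leq_maxl|apply: Ne => /=; exact: leq_maxr].
split=> [n|c uc]; apply/ler_addgt0Pr => e e0.
  have [m nm lm] := near_l e n e0.
  rewrite (le_trans (le_u _ _ nm))// -lerBlDl (le_trans _ (ltW lm))//.
  by rewrite distrC real_ler_norm ?realB.
have [m _ lm] := near_l e 0%N e0.
rewrite -(subrK (u m) l) addrC lerD//.
by rewrite (le_trans _ (ltW lm))// real_ler_norm ?realB.
Qed.

(** * Bounded operators *)

Section Bounded.
Context (R : realType).
Implicit Types X Y Z : hilbertType R.

Lemma bop_continuous X Y (T : 'B(X, Y)) : continuous T.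
Proof.
have [M M0 TM] := bop_bounded T.
move=> x; apply/cvgrPdist_lt => e e0.
have M1 : 0 < M + 1 by rewrite ltr_wpDl.
near=> y; rewrite -linearB (le_lt_trans (TM _))//.
rewrite (@le_lt_trans _ _ ((M + 1) * `|x - y|))//.
  by rewrite ler_wpM2r// lerDl.
rewrite mulrC -ltr_pdivlMr//; near: y.
by apply: cvgr_dist_lt; [exact: cvg_id|exact: divr_gt0].
Unshelve. all: by end_near. Qed.

Definition bop_pair X Y Z (A : 'B(X, Y)) (B : 'B(X, Z)) : X -> Y * Z :=
  fun x => (A x, B x).

Lemma bop_pair_continuous X Y Z (A : 'B(X, Y)) (B : 'B(X, Z)) :
  continuous (bop_pair A B).
Proof. by move=> x; apply: cvg_pair; exact: bop_continuous. Qed.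

Lemma quotientE X Y Z (A : 'B(X, Y)) (B : 'B(X, Z)) :
  quotient B A = range (bop_pair A B).
Proof.
apply/seteqP; split=> [[u v] [x /= ux vx]|_ [x _ <-]]; exists x => //.
by rewrite /bop_pair -ux -vx.
Qed.

Lemma innerDr X (z x y : X) : inner z (x + y) = inner z x + inner z y.
Proof. exact: linearDr. Qed.

Lemma innerBr X (z x y : X) : inner z (x - y) = inner z x - inner z y.
Proof. exact: linearBr. Qed.

Lemma inner_normB X (x y : X) : inner x y \is Num.real ->
  `|x - y| ^+ 2 = `|x| ^+ 2 + `|y| ^+ 2 - inner x y *+ 2.
Proof.
move=> xyr; rewrite -!inner_norm.
have -> : inner (x - y) (x - y) =
  inner x x + inner y y - (inner x y + Num.conj (inner x y)) by exact: dnormB.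
by rewrite (CrealP xyr) mulr2n.
Qed.

Lemma innerZr X (a : R[i]) (x y : X) : a \is Num.real ->
  inner x (a *: y) = a * inner x y.
Proof.
move=> ar; have -> : inner x (a *: y) = Num.conj a * inner x y.
  exact: linearZr_LR.
by rewrite (CrealP ar).
Qed.

Lemma inner_sep X (x y : X) : (forall z, inner z x = inner z y) -> x = y.
Proof.
move=> xy; apply/eqP; rewrite -subr_eq0 -normr_eq0 -sqrf_eq0 -inner_norm.
by rewrite innerBr subr_eq0 xy.
Qed.

(** This is [A'A + B'B]; it is the Gram operator of the map [bop_pair A B] when
    [A'] and [B'] are the adjoints of [A] and [B]. *)
Definition gram X Y Z (A : 'B(X, Y)) (A' : 'B(Y, X)) (B : 'B(X, Z))
  (B' : 'B(Z, X)) : 'B(X, X) := bop_add (bop_comp A' A) (bop_comp B' B).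

Section Gram.
Context (X Y Z : hilbertType R).
Context (A : 'B(X, Y)) (A' : 'B(Y, X)) (B : 'B(X, Z)) (B' : 'B(Z, X)).
Hypotheses (AA' : is_adjoint A A') (BB' : is_adjoint B B').
Let T := gram A A' B B'.

Lemma inner_gram x y : inner x (T y) = inner (A x) (A y) + inner (B x) (B y).
Proof. by rewrite /= innerDr AA' BB'. Qed.

Lemma inner_gramE x : inner x (T x) = `|A x| ^+ 2 + `|B x| ^+ 2.
Proof. by rewrite inner_gram !inner_norm. Qed.

(** A bounded [T >= 0] satisfies [T^2 <= M T].  Here it follows from bounds on
    [A'] and [B'] and from [(s + t)^2 <= 2 (s^2 + t^2)]. *)
Lemma gram_bound :
  exists2 M, 0 < M & forall x, `|T x| ^+ 2 <= M * inner x (T x).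
Proof.
have [a a0 Aa] := bop_bounded A'; have [b b0 Bb] := bop_bounded B'.
exists ((a + b + 1) ^+ 2 * 2) => [|x].
  by rewrite mulr_gt0// exprn_gt0// ltr_wpDl// addr_ge0.
rewrite inner_gramE -mulrA.
apply: (@le_trans _ _ (((a + b + 1) * (`|A x| + `|B x|)) ^+ 2)).
  rewrite lerXn2r ?nnegrE ?normr_ge0 ?mulr_ge0 ?addr_ge0//.
  rewrite (le_trans (ler_normD _ _))// mulrDr lerD//.
    by rewrite (le_trans (Aa _))// ler_wpM2r// -addrA lerDl addr_ge0.
  by rewrite (le_trans (Bb _))// ler_wpM2r// [a + b]addrC -addrA lerDl addr_ge0.
rewrite exprMn ler_wpM2l ?exprn_ge0 ?addr_ge0//.
rewrite -subr_ge0.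
have -> : 2 * (`|A x| ^+ 2 + `|B x| ^+ 2) - (`|A x| + `|B x|) ^+ 2 =
    (`|A x| - `|B x|) ^+ 2.
  by ring.
by rewrite real_exprn_even_ge0// realB ?normr_real.
Qed.

(** Iterate [U = 1 - T / M].  By [gram_bound] each step decreases the squared
    norm by at least [<x, T x> / M], so these decrements become arbitrarily
    small along the orbit of [g], and every point of that orbit differs from
    [g] by an element of the range of [T]. *)
Lemma gram_approx g e : 0 < e -> exists r, inner (g - T r) (T (g - T r)) < e.
Proof.
move=> e0; have [M M0 TM] := gram_bound.
pose U x := x - M^-1 *: T x.
have UE n : exists r, iter n U g = g - T r.
  elim: n => [|n [r IHn]]; first by exists 0; rewrite linear0 subr0.
  exists (r + M^-1 *: (g - T r)).
  by rewrite iterS IHn /U [T (r + _)]linearD [T (_ *: _)]linearZ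
    [in RHS]opprD [RHS]addrA.
have q_ge0 x : 0 <= inner x (T x).
  by rewrite inner_gramE addr_ge0// exprn_ge0.
have U_le x : `|U x| ^+ 2 <= `|x| ^+ 2 - M^-1 * inner x (T x).
  have Mr : M^-1 \is Num.real by rewrite gtr0_real ?invr_gt0.
  have xTr : inner x (T x) \is Num.real by rewrite ger0_real.
  rewrite /U inner_normB innerZr ?realM// normrZ (gtr0_norm (_ : 0 < M^-1)) ?invr_gt0//.
  rewrite -addrA lerD2l mulr2n opprD addrA gerDr subr_le0 exprMn expr2 -mulrA.
  by rewrite ler_wpM2l ?invr_ge0 ?(ltW M0)// ler_pdivrMl.
have [n qn] : exists n, M^-1 * inner (iter n U g) (T (iter n U g)) < M^-1 * e.
  apply: (descent_small (a := fun n => `|iter n U g| ^+ 2)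
      (q := fun n => M^-1 * inner (iter n U g) (T (iter n U g)))) => [n|n|n|] /=.
  - by rewrite exprn_ge0.
  - by rewrite mulr_ge0// invr_ge0 ltW.
  - exact: U_le.
  - by rewrite mulr_gt0// invr_gt0.
have [r rE] := UE n; exists r; rewrite -rE.
by rewrite ltr_pM2l ?invr_gt0 in qn.
Qed.

(** Every pair in [L(A, B)] is a limit of pairs coming from the range of [T],
    since [<x, T x>] is the squared Euclidean norm of [(A x, B x)]. *)
Lemma gram_pair_dense g :
  closure (bop_pair A B @` range T) (bop_pair A B g).
Proof.
apply/closure_normP => e e0.
have [r] := gram_approx g (exprn_gt0 2 e0).
rewrite inner_gramE => re; exists (bop_pair A B (T r)).
  by exists (T r) => //; exists r.
rewrite prod_normE /= -!linearB comparable_gt_max ?real_comparable ?normr_real//.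
have sq (t : R[i]) : 0 <= t -> t ^+ 2 < e ^+ 2 -> t < e.
  by move=> t0; rewrite ltr_pXn2r ?nnegrE// ltW.
apply/andP; split; apply: sq; rewrite ?normr_ge0//; apply: le_lt_trans re.
  by rewrite lerDl exprn_ge0.
by rewrite lerDr exprn_ge0.
Qed.

(** [T] is the composite of [bop_pair A B] with the continuous map
    [(u, v) |-> A' u + B' v], which transports the previous approximation. *)
Lemma gram_range_dense : closure (range T) `<=` closure (range (T \o T)).
Proof.
rewrite [X in _ `<=` X](closure_id _).1; last exact: closed_closure.
apply: closure_subset => _ [g _ <-].
have c : continuous (fun p : Y * Z => A' p.1 + B' p.2).
  move=> p; apply: cvgD.
    by apply: continuous_comp; [exact: cvg_fst|exact: bop_continuous].
  by apply: continuous_comp; [exact: cvg_snd|exact: bop_continuous].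
have := closure_image c (@gram_pair_dense g); apply: closure_subset.
by move=> _ [_ [_ [r _ <-] <-] <-]; exists r.
Qed.

End Gram.

Section KernelInclusion.
Context (X Y Z : hilbertType R).
Implicit Types (A : 'B(X, Y)) (B : 'B(X, Z)).

Lemma dominated_almost A B : dominated B A -> almost_dominated B A.
Proof.
move=> [c c0 BcA]; exists (fun=> Z), (fun=> B), (fun=> c); split=> [_|f].
  exact: ltW.
by split=> //; exact: cvg_cst.
Qed.

(** Choose [f] with [A f] near [0] and [B f] near [y], then for each [n] a much
    better [f'].  Then [B_n f'] is small by domination of [B_n], while
    [B_n (f - f')] is at most [B (f - f')], which is small because [B f] and
    [B f'] are both near [y].  So all [B_n f], hence [B f] and [y], are small,
    uniformly in [n]. *)
Lemma almost_dominated_closable A B y : almost_dominated B A ->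
  closure (Lrel A B) (0, y) -> y = 0.
Proof.
move=> [K_ [B_ [c [c0 Bc]]]] /closure_normP Ly.
have near_y e : 0 < e -> exists2 f, `|A f| < e & `|y - B f| < e.
  move=> /Ly[_ [f _ <-]]; rewrite prod_normE /= sub0r normrN.
  by rewrite comparable_gt_max ?real_comparable ?normr_real// => /andP[]; exists f.
have BnB n f : `|B_ n f| <= `|B f|.
  have [_ mon lim] := Bc f.
  by apply: (nondecreasing_cvg_bounds (fun n => normr_real _) (normr_real _) mon lim).1.
apply/eqP; rewrite -normr_le0; apply/ler_addgt0Pr => e e0; rewrite add0r.
have e40 : 0 < e / 4 by rewrite divr_gt0.
have [f Af Bf] := near_y _ e40.
have Bn_small n : `|B_ n f| <= e / 4 *+ 3.
  have cn0 : 0 < c n + 1 by rewrite ltr_wpDl.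
  (* The radius beats the constant [c n] and stays below [e / 4]. *)
  have [f' Af' Bf'] := near_y (e / 4 / (c n + 1)) (divr_gt0 e40 cn0).
  have Bff' : `|B (f - f')| <= e / 4 *+ 2.
    rewrite linearB -(subrK y (B f)) -addrA mulr2n (le_trans (ler_normD _ _))//.
    rewrite lerD//; first by rewrite distrC ltW.
    by rewrite (le_trans (ltW Bf'))// ler_pdivrMr// ler_peMr ?(ltW e40)// lerDr.
  have Bnf' : `|B_ n f'| <= e / 4.
    have [/(_ n)/le_trans-> //] := Bc f'.
    rewrite (le_trans (ler_wpM2l (c0 n) (ltW Af')))// mulrA ler_pdivrMr//.
    by rewrite mulrC ler_pM2l// lerDl.
  rewrite -(subrK f' f) linearD (le_trans (ler_normD _ _))// mulrSr lerD//.
  exact: le_trans (BnB _ _) Bff'.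
have Bf_small : `|B f| <= e / 4 *+ 3.
  have [_ mon lim] := Bc f.
  by apply: (nondecreasing_cvg_bounds (fun n => normr_real _) (normr_real _) mon lim).2.
rewrite -(subrK (B f) y) (le_trans (ler_normD _ _))//.
apply: (le_trans (lerD (ltW Bf) Bf_small)).
by rewrite [leRHS](_ : _ = e / 4 + e / 4 *+ 3)//; field.
Qed.

End KernelInclusion.
End Bounded.

(** * The derivative as a quotient *)

Theorem theorem7p7 (R : realType) (E H K : hilbertType R)
    (A : 'B(E, H)) (B : 'B(E, K)) (A' : 'B(H, E)) (B' : 'B(K, E)) :
  is_adjoint A A' -> is_adjoint B B' ->
  dominated B A \/ almost_dominated B A ->
  let E0 := clos_ran (bop_add (bop_comp A' A) (bop_comp B' B)) in
  let A0 := bop_restr A E0 in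
  let B0 := bop_restr B E0 in
  forall (A0' : 'B(H, E0)) (B0' : 'B(K, E0)) (S : 'B(E0, E0))
         (CA0 : 'B(E0, H)) (CB0 : 'B(E0, K)),
  is_adjoint A0 A0' -> is_adjoint B0 B0' ->
  is_sqrt (bop_add (bop_comp A0' A0) (bop_comp B0' B0)) S ->
  (forall f : E0, A0 f = CA0 (S f)) ->
  (forall f : E0, B0 f = CB0 (S f)) ->
  RNderiv A B = quotient CB0 CA0 /\ ker CA0 `<=` ker CB0.
Proof.
move=> AA' BB' domBA E0 A0 B0 A0' B0' S CA0 CB0 AA0' BB0' [[S_adj _] SS]
  CAS CBS.
pose T := gram A A' B B'.
have T_E0 g : csub_pred E0 (T g).
  by apply/mem_set/subset_closure; exists g.
pose t g : E0 := Csub (T_E0 g).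
(* [S S] agrees with [T] on [E0], as they have the same inner products with [E0]. *)
have S_dense : closure (range S) = setT.
  apply/seteqP; split=> // x _; apply/closure_normP => e e0.
  have /(gram_range_dense AA' BB')/closure_normP/(_ e e0)[_ [r _ <-] xr] :
    closure (range T) (val x) by apply/set_mem; case: x.
  exists (S (S (t r))); first by exists (S (t r)).
  suff -> : S (S (t r)) = t (T r) by [].
  rewrite SS; apply: inner_sep => z.
  rewrite (inner_gram AA0' BB0').
  by rewrite -[RHS]/(inner (val z) (T (T r))) (inner_gram AA' BB').
have AS f : A (val f) = CA0 (S f) by rewrite -CAS.
have BS f : B (val f) = CB0 (S f) by rewrite -CBS.
have norm_S f : `|S f| ^+ 2 = `|CA0 (S f)| ^+ 2 + `|CB0 (S f)| ^+ 2.
  by rewrite -inner_norm S_adj SS (inner_gramE AA0' BB0') CAS CBS.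
pose V := bop_pair CA0 CB0.
have V_cont : continuous V by exact: bop_pair_continuous.
(* The factor 2 passes from the sum of the two norms to their maximum, which is
   the norm of the product space. *)
have V_below x : `|x| <= 2 * `|V x|.
  apply: (bounded_below_dense _ V_cont S_dense) => // _ [f _ <-].
  apply: (@le_trans _ _ (`|CA0 (S f)| + `|CB0 (S f)|)).
    rewrite -(@ler_pXn2r _ 2) ?nnegrE ?addr_ge0// norm_S sqrrD lerD2r.
    by rewrite lerDl mulrn_wge0// mulr_ge0.
  rewrite mulr_natl mulr2n prod_normE /= lerD//.
    by rewrite comparable_le_max ?real_comparable ?normr_real// lexx.
  by rewrite comparable_le_max ?real_comparable ?normr_real// lexx orbT.
have V_closed : closed (range V).
  apply: (@closed_range_expanding _ _ _ 2) => // x y.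
  by rewrite (le_trans (V_below _))// /V /bop_pair !linearB.
have RNE : RNderiv A B = range V.
  apply/seteqP; split.
    have closVE : closure (range V) = range V by rewrite -(closure_id _).1.
    rewrite -closVE; apply: closure_subset => _ [g _ <-]; rewrite -closVE.
    have := gram_pair_dense AA' BB' (g := g); apply: closure_subset.
    move=> _ [_ [r _ <-] <-]; exists (S (t r)) => //.
    by rewrite /V /bop_pair -AS -BS.
  move=> _ [x _ <-].
  have /(closure_image V_cont) : closure (range S) x by rewrite S_dense.
  apply: closure_subset => _ [_ [f _ <-] <-].
  by exists (val f) => //; rewrite /V /bop_pair AS BS.
split; first by rewrite quotientE.
move=> x CAx; apply: (@almost_dominated_closable _ _ _ _ A B).
  by case: domBA => // /dominated_almost.
by rewrite -[closure _]/(RNderiv A B) RNE; exists x; rewrite // /V /bop_pair CAx.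
Qed.
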